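(* Let $(\mathcal C,\mathcal S,E,F)$ be a bipartite matching structure and $\phi$ a sub-additive admissible matching policy such that every buffer detail $(\mathbf w,\mathbf z)\in\mathcal U_0$ admits an erasing couple for $((\mathcal C,\mathcal S,E,F),\phi)$. Assume that the input is i.i.d. (i.e. under $\mathbb P^0$ the coordinates of $\Omega^0$ are i.i.d.), and that for every $V\in\mathscr V^\infty$ the stopping time $$\tau_1(V)=\inf\{n>0:\ U^{[V]}_n=\emptyset\}$$ is $\mathbb P^0$-integrable. Then there exists a unique solution $U^*$ in $\mathscr V^\infty$ to $$U^*\circ\theta=U^*\odot_\phi(\mathsf C,\mathsf S,\Sigma,\Gamma)\quad\mathbb P^0\text{-a.s.}$$ such that $\mathbb P^0[U^*=\emptyset]>0$, and to which all sequences $(U^{[V]}_n)_{n\in\mathbb N}$, for $V\in\mathscr V^\infty$, converge with strong backwards coupling (that is, they converge with strong backwards coupling to $(U^*\circ\theta^n)_{n\in\mathbb N}$).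
   Context: **Structure.** A bipartite matching structure is a quadruple $(\mathcal C,\mathcal S,E,F)$ where $\mathcal C$ (customer classes) and $\mathcal S$ (server classes) are disjoint non-empty finite sets, $E\subset\mathcal C\times\mathcal S$ (possible matchings) and $F\subset\mathcal C\times\mathcal S$ (possible arrivals). Standing assumptions: the bipartite graph $(\mathcal C\cup\mathcal S,E)$ is connected, and $(\mathcal C\cup\mathcal S,F)$ has no isolated vertex. Put $\mathcal S(c)=\{s:(c,s)\in E\}$, $\mathcal C(s)=\{c:(c,s)\in E\}$. **Words.** $A^*$ is the set of finite words over $A$; $|\mathbf w|$ is the length of $\mathbf w$, $|\mathbf w|_B$ the number of letters of $\mathbf w$ lying in $B$ (and $|\mathbf w|_b=|\mathbf w|_{\{b\}}$), $\mathbf w_{[i]}$ is $\mathbf w$ with its $i$-th letter deleted. $\emptyset$ denotes both the empty word and the pair of empty words. **Lists of preferences.** $\mathbb S=\prod_{c\in\mathcal C}\mathrm{Sym}(\mathcal S(c))$ and $\mathbb C=\prod_{s\in\mathcal S}\mathrm{Sym}(\mathcal C(s))$, where $\mathrm{Sym}(A)$ is the set of orderings (permutations) of $A$. **States.** $\mathcal U$ is the set of $(\mathbf w,\mathbf z)\in\mathcal C^*\times\mathcal S^*$ with $|\mathbf w|_i|\mathbf z|_j=0$ for all $(i,j)\in E$ (buffer details), and $\mathcal U_0=\{(\mathbf w,\mathbf z)\in\mathcal U:|\mathbf w|=|\mathbf z|\}$. **Admissible policy.** An admissible matching policy $\phi$ chooses, as a function only of the current state $(\mathbf w,\mathbf z)\in\mathcal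 U$, of the entering couple $(c,s)\in\mathcal C\times\mathcal S$ and of the lists $(\sigma,\gamma)\in\mathbb S\times\mathbb C$: a position $k$ with $w_k\in\mathcal C(s)$ whenever $|\mathbf w|_{\mathcal C(s)}\neq0$, and a position $l$ with $z_l\in\mathcal S(c)$ whenever $|\mathbf z|_{\mathcal S(c)}\ne0$. The new state $(\mathbf w,\mathbf z)\odot_\phi(c,s,\sigma,\gamma)$ is: - $(\mathbf wc,\mathbf zs)$ if $|\mathbf w|_{\mathcal C(s)}=|\mathbf z|_{\mathcal S(c)}=0$ and $(c,s)\notin E$; - $(\mathbf w,\mathbf z)$ if $|\mathbf w|_{\mathcal C(s)}=|\mathbf z|_{\mathcal S(c)}=0$ and $(c,s)\in E$; - $(\mathbf w_{[k]},\mathbf z_{[l]})$ if $|\mathbf w|_{\mathcal C(s)}\ne0$ and $|\mathbf z|_{\mathcal S(c)}\neq0$; - $(\mathbf w_{[k]}c,\mathbf z)$ if $|\mathbf w|_{\mathcal C(s)}\neq0$ and $|\mathbf z|_{\mathcal S(c)}=0$; - $(\mathbf w,\mathbf z_{[l]}s)$ if $|\mathbf w|_{\mathcal C(s)}=0$ and $|\mathbf z|_{\mathcal S(c)}\ne0$. (The update makes sense for all couples in $\mathcal C\times\mathcal S$; only couples of $F$ actually arrive.) For words $\mathbf c\in\mathcal C^*,\mathbf s\in\mathcal S^*,\boldsymbol\sigma\in\mathbb S^*,\boldsymbol\gamma\in\mathbb C^*$ of the same length, $Q_\phi(\mathbf c,\mathbf s,\boldsymbol\sigma,\boldsymbol\gamma)=(C_\phi(\mathbf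 c,\mathbf s,\boldsymbol\sigma,\boldsymbol\gamma),S_\phi(\mathbf c,\mathbf s,\boldsymbol\sigma,\boldsymbol\gamma))$ is the state reached from $\emptyset$ after applying successively the inputs $(c_1,s_1,\sigma_1,\gamma_1),(c_2,s_2,\sigma_2,\gamma_2),\dots$ **Sub-additivity.** $\phi$ is sub-additive if for all words $\mathbf c',\mathbf s',\boldsymbol\sigma',\boldsymbol\gamma'$ of a common length and $\mathbf c'',\mathbf s'',\boldsymbol\sigma'',\boldsymbol\gamma''$ of a common length, $|C_\phi(\mathbf c'\mathbf c'',\mathbf s'\mathbf s'',\boldsymbol\sigma'\boldsymbol\sigma'',\boldsymbol\gamma'\boldsymbol\gamma'')|\le|C_\phi(\mathbf c',\mathbf s',\boldsymbol\sigma',\boldsymbol\gamma')|+|C_\phi(\mathbf c'',\mathbf s'',\boldsymbol\sigma'',\boldsymbol\gamma'')|$ and the same inequality holds with $S_\phi$ in place of $C_\phi$. **Erasing couple.** An admissible input is a pair $(\mathbf c,\mathbf s)$ of words of equal length with $(c_i,s_i)\in F$ for all $i$. It is an erasing couple of $(\mathbf w,\mathbf z)\in\mathcal U_0$ for $((\mathcal C,\mathcal S,E,F),\phi)$ if for all $\boldsymbol\sigma,\boldsymbol\sigma'\in\mathbb S^*$ and $\boldsymbol\gamma,\boldsymbol\gamma'\in\mathbb C^*$ with $|\boldsymbol\sigma|=|\boldsymbol\gamma|=|\mathbf w|$ and $|\boldsymbol\sigma'|=|\boldsymbol\gamma'|=|\mathbf c|$, one has $Q_\phi(\mathbf c,\mathbf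 s,\boldsymbol\sigma',\boldsymbol\gamma')=\emptyset$ and $Q_\phi(\mathbf w\mathbf c,\mathbf z\mathbf s,\boldsymbol\sigma\boldsymbol\sigma',\boldsymbol\gamma\boldsymbol\gamma')=\emptyset$. **Probabilistic setting.** $\Omega^0=(F\times\mathbb S\times\mathbb C)^{\mathbb Z}$ with its product $\sigma$-field $\mathscr F^0$, $\theta$ is the shift $\theta((\omega_n)_n)=(\omega_{n+1})_n$, and $\mathbb P^0$ is the law of the bi-infinite input sequence (classes of entering couples and lists of preferences). The marginal law $\mu$ on $F$ of one entering couple has full support $F$. $(\mathsf C,\mathsf S,\Sigma,\Gamma)$ is the $0$-coordinate map on $\Omega^0$. For a $\mathcal U_0$-valued random variable $V$ on $\Omega^0$, $(U^{[V]}_n)_{n\ge0}$ is defined by $U^{[V]}_0=V$, $U^{[V]}_{n+1}=U^{[V]}_n\odot_\phi\bigl((\mathsf C,\mathsf S,\Sigma,\Gamma)\circ\theta^n\bigr)$. $\mathscr V^r$ is the set of $\mathcal U_0$-valued random variables $(W,Z)$ with $|W|=|Z|\le r$ a.s., and $\mathscr V^\infty=\bigcup_{r\ge1}\mathscr V^r$. $(U^{[V]}_n)_n$ converges with strong backwards coupling to $(U\circ\theta^n)_n$ if, $\mathbb P^0$-a.s., there is $N^*\ge0$ such that $U^{[V]}_n\circ\theta^{-n}=U$ for all $n\ge N^*$.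
   Formalization: The solution U* is a U_0-valued (a.s. finite) random variable, not a member of V^∞, since a.s. bounded solutions need not exist (e.g. a reflected random walk); uniqueness is proved among all U_0-valued solutions, while convergence is for all V in V^∞. *)

(* Defs.v *)
From HB Require Import structures.
From mathcomp Require Import all_boot all_order all_algebra all_fingroup.
From mathcomp Require Import all_classical all_reals all_analysis.

Set Implicit Arguments.
Unset Strict Implicit.
Unset Printing Implicit Defensive.

Import Order.TTheory GRing.Theory Num.Theory.

Local Open Scope classical_set_scope.

Definition bip_adj (C S : finType) (A : {set C * S}) : rel (C + S) :=
  fun x y => match x, y with
             | inl c, inr s => (c, s) \in A
             | inr s, inl c => (c, s) \in A
             | _, _ => false
             end.

Record matching_structure (C S : finType) := MatchingStructure {
  matchings : {set C * S};
  arrivals : {set C * S};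
  customers_nonempty : 0 < #|C|;
  servers_nonempty : 0 < #|S|;
  matchings_connected : forall x y, connect (bip_adj matchings) x y;
  arrivals_not_isolated : forall x, exists y, bip_adj arrivals x y }.

Section Model.
Variables (C S : finType) (M : matching_structure C S).

Definition servers_of (c : C) : {set S} := [set s | (c, s) \in matchings M].
Definition customers_of (s : S) : {set C} := [set c | (c, s) \in matchings M].

Definition customer_prefs :=
  {dffun forall c : C, {perm {s : S | s \in servers_of c}}}.
Definition server_prefs :=
  {dffun forall s : S, {perm {c : C | c \in customers_of s}}}.

Definition letter := (C * S * customer_prefs * server_prefs)%type.

Definition state := (seq C * seq S)%type.
Definition empty_state : state := ([::], [::]).

Definition buffer_detail (u : state) : bool :=
  [forall e in matchings M, count_mem e.1 u.1 * count_mem e.2 u.2 == 0].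

Definition balanced_detail (u : state) : bool :=
  buffer_detail u && (size u.1 == size u.2).

(* Positions are numbered from 0.  The choice functions are total; a value *)
(* outside the cases of customer_choiceP (resp. server_choiceP) is never   *)
(* used from a buffer detail.                                              *)
Record admissible_policy := AdmissiblePolicy {
  customer_choice : state -> letter -> nat;
  server_choice : state -> letter -> nat;
  customer_choiceP : forall (u : state) c s sg gm, buffer_detail u ->
    count (mem (customers_of s)) u.1 != 0 ->
    let k := customer_choice u (c, s, sg, gm) in
    k < size u.1 /\ nth c u.1 k \in customers_of s;
  server_choiceP : forall (u : state) c s sg gm, buffer_detail u ->
    count (mem (servers_of c)) u.2 != 0 ->
    let l := server_choice u (c, s, sg, gm) in
    l < size u.2 /\ nth s u.2 l \in servers_of c }.

Definition delete (A : Type) (w : seq A) (k : nat) : seq A :=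
  take k w ++ drop k.+1 w.

Variable phi : admissible_policy.

Definition odot (u : state) (x : letter) : state :=
  let: (w, z) := u in
  let: (c, s, _, _) := x in
  let k := customer_choice phi u x in
  let l := server_choice phi u x in
  match count (mem (customers_of s)) w != 0,
        count (mem (servers_of c)) z != 0 with
  | false, false => if (c, s) \in matchings M then (w, z)
                    else (rcons w c, rcons z s)
  | true, true => (delete w k, delete z l)
  | true, false => (rcons (delete w k) c, z)
  | false, true => (w, rcons (delete z l) s)
  end.

Definition Q (c : seq C) (s : seq S) (sg : seq customer_prefs)
    (gm : seq server_prefs) : state :=
  foldl odot empty_state (zip (zip (zip c s) sg) gm).

Definition sub_additive : Prop :=
  forall (c1 c2 : seq C) (s1 s2 : seq S) (sg1 sg2 : seq customer_prefs)
         (gm1 gm2 : seq server_prefs),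
    size s1 = size c1 -> size sg1 = size c1 -> size gm1 = size c1 ->
    size s2 = size c2 -> size sg2 = size c2 -> size gm2 = size c2 ->
    let u := Q (c1 ++ c2) (s1 ++ s2) (sg1 ++ sg2) (gm1 ++ gm2) in
    size u.1 <= size (Q c1 s1 sg1 gm1).1 + size (Q c2 s2 sg2 gm2).1 /\
    size u.2 <= size (Q c1 s1 sg1 gm1).2 + size (Q c2 s2 sg2 gm2).2.

Definition admissible_input (c : seq C) (s : seq S) : Prop :=
  size s = size c /\ {subset zip c s <= arrivals M}.

Definition erasing_couple (u : state) (c : seq C) (s : seq S) : Prop :=
  admissible_input c s /\
  forall (sg sg' : seq customer_prefs) (gm gm' : seq server_prefs),
    size sg = size u.1 -> size gm = size u.1 ->
    size sg' = size c -> size gm' = size c ->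
    Q c s sg' gm' = empty_state /\
    Q (u.1 ++ c) (u.2 ++ s) (sg ++ sg') (gm ++ gm') = empty_state.

End Model.

Section Inputs.
Variables (C S : finType) (M : matching_structure C S).

Definition arrival := {x : C * S | x \in arrivals M}.

HB.instance Definition _ := Finite.on arrival.

Definition input := (arrival * customer_prefs M * server_prefs M)%type.

HB.instance Definition _ := Finite.on input.

(* measurableType requires a pointed carrier. *)
Lemma input_inhabited : 0 < #|{: input}|.
Proof.
have /card_gt0P[c _] := customers_nonempty M.
have [[c'|s] //= Fcs] := arrivals_not_isolated M (inl c).
apply/card_gt0P.
by exists (exist _ (c, s) Fcs, [ffun=> 1%g], [ffun=> 1%g]).
Qed.

HB.instance Definition _ :=
  isPointed.Build input (enum_val (Ordinal input_inhabited)).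

Definition letter_of (x : input) : letter M := (val x.1.1, x.1.2, x.2).

(* Product sigma-field of the discrete one on the finite type of inputs. *)
Definition cylinders : set (set (int -> input)) :=
  [set A | exists (n : int) (B : set input), A = [set om | B (om n)]].

Definition Omega := g_sigma_algebraType cylinders.

HB.instance Definition _ := Measurable.on Omega.

(* theta = time_shift 1, and time_shift k is theta^k for every k : int. *)
Definition time_shift (k : int) (om : Omega) : Omega :=
  fun n => om (n + k)%R.

Definition input0 (om : Omega) : input := om 0%R.

End Inputs.

Section Probability.
Variables (R : realType) (C S : finType) (M : matching_structure C S).
Variable P : probability (Omega M) R.

Definition iid : Prop :=
  (forall (n : int) (B : set (input M)),
     P [set om | B (om n)] = P [set om | B (om 0%R)]) /\
  (forall (ns : seq int) (B : int -> set (input M)), uniq ns ->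
     P [set om | forall n, n \in ns -> B n (om n)] =
     (\prod_(n <- ns) P [set om | B n (om n)])%E).

Definition full_support : Prop :=
  forall x : arrival M, (0 < P [set om | (input0 om).1.1 = x])%E.

(* The countable set of states carries its discrete sigma-field. *)
Definition balanced_rv (V : Omega M -> state C S) : Prop :=
  (forall om, balanced_detail M (V om)) /\
  (forall A : set (state C S), measurable (V @^-1` A)).

Definition bounded_rv (r : nat) (V : Omega M -> state C S) : Prop :=
  balanced_rv V /\
  {ae P, forall om, size (V om).1 = size (V om).2 /\ size (V om).2 <= r}.

Definition Vinfty (V : Omega M -> state C S) : Prop :=
  exists2 r, 1 <= r & bounded_rv r V.

Variable phi : admissible_policy M.

Fixpoint recur (V : Omega M -> state C S) (n : nat) (om : Omega M) :
    state C S :=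
  if n is n'.+1
  then odot phi (recur V n' om) (letter_of (input0 (time_shift n'%:Z om)))
  else V om.

(* Equal to +oo when the empty state is never visited. *)
Definition tau1 (V : Omega M -> state C S) (om : Omega M) : \bar R :=
  ereal_inf [set (n%:R)%:E | n in
    [set n | 0 < n /\ recur V n om = empty_state C S]].

Definition stationary_solution (U : Omega M -> state C S) : Prop :=
  {ae P, forall om,
    U (time_shift 1%R om) = odot phi (U om) (letter_of (input0 om))}.

Definition strong_backwards_coupling (V U : Omega M -> state C S) : Prop :=
  {ae P, forall om, exists N, forall n, N <= n ->
    recur V n (time_shift (- n%:Z)%R om) = U om}.

End Probability.

(* Main.v *)
Require Import Defs.
From mathcomp Require Import all_boot all_order all_algebra all_fingroup.
From mathcomp Require Import all_classical all_reals all_analysis.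
From mathcomp Require Import measurable_realfun lra zify.

(** The idea of the proof.

A buffer detail is the state reached from the empty one when its own letters are
fed in order.  By sub-additivity, the size of any chain exceeds that of the chain
started empty and driven by the same input by at most the initial size
([size_run]).  Hence, each time the chain started empty is empty again, all the
chains started from balanced details of size at most [r] are back in this finite
set, the ball of radius [r].  Erasing couples have positive probability, and
concatenating finitely many of them yields one word that sends the whole ball to
the empty state ([coupling_word]).  As returns to the empty state have finite
mean by integrability of [tau1], a renewal argument bounds the mean time after
which all the chains of the ball have merged ([uncoupled_time_bounded]).

The probability that the chains started in the ball at time [- n] have not merged
at time zero is a tail probability of that coupling time, hence summable in [n].
By Borel-Cantelli, almost surely they have merged for all large [n]
([ae_eventually_coupled]).  Since the chain started empty at time [- (n + 1)] is
in the ball of radius 1 at time [- n], the state at time zero of the chain started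
empty at time [- n] is eventually constant in [n] ([past_state_stable]).  The
solution is this constant ([past_limit]); it is stationary because shifting the
input adds one letter on the right of every window.  Coupling of larger balls,
with invariance of [P] under the shift, gives strong backwards coupling from
every bounded initial value ([strong_coupling]).

A stationary solution need not be bounded, but along the past orbit it comes back
infinitely often below some level ([ae_recurrent]); at these times it coincides
with a bounded initial value, which couples with [past_limit]
([stationary_unique]).  Finally, the state at time zero of the chain started empty
at time [- n] is empty with a probability bounded away from zero for large [n],
since its size stays bounded with probability at least 1/2 and an erasing word
may follow ([P_past_limit_empty]). *)

Set Implicit Arguments.
Unset Strict Implicit.
Unset Printing Implicit Defensive.

Import Order.TTheory GRing.Theory Num.Theory.

Local Open Scope classical_set_scope.

(** * Dynamics on buffer details *)

Section Dynamics.
Variables (C S : finType) (M : matching_structure C S).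
Variable phi : admissible_policy M.

Local Notation state := (state C S).
Local Notation empty := (empty_state C S).

(** Membership is easier to propagate through the moves of a policy than the
products of multiplicities. *)
Lemma buffer_detailP (u : state) :
  reflect (forall c s, c \in u.1 -> s \in u.2 -> (c, s) \notin matchings M)
          (buffer_detail M u).
Proof.
apply: (iffP forall_inP) => [H c s cu su | H [c s] cs].
  apply/negP => /H /=; rewrite muln_eq0 !eqn0Ngt -!has_count.
  by rewrite !has_pred1 cu su.
rewrite muln_eq0 !eqn0Ngt -!has_count !has_pred1 -negb_and.
by apply/negP => /andP[/= cu su]; move: cs; rewrite (negbTE (H _ _ cu su)).
Qed.

Lemma balanced_size (u : state) : balanced_detail M u -> size u.1 = size u.2.
Proof. by case/andP => _ /eqP. Qed.

Lemma balanced_empty : balanced_detail M empty.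
Proof. by rewrite /balanced_detail eqxx andbT; apply/buffer_detailP. Qed.

Lemma mem_delete (A : eqType) (w : seq A) k x : x \in delete w k -> x \in w.
Proof. by rewrite mem_cat => /orP[/mem_take|/mem_drop]. Qed.

Lemma size_delete (A : Type) (w : seq A) k :
  k < size w -> size (delete w k) = (size w).-1.
Proof.
move=> kw; rewrite size_cat size_take size_drop kw.
by rewrite subnS -subn1 -subn1 addnBA ?subnKC ?subn_gt0 // ltnW.
Qed.

Lemma count_neq0 (A : finType) (B : {set A}) (w : seq A) :
  (count (mem B) w != 0) = has (mem B) w.
Proof. by rewrite -lt0n -has_count. Qed.

(** A letter enters the buffer only when nothing on the opposite side matches
it, and a customer and a server that enter together do not match each other;
deleting letters creates no matching pair. *)
Lemma balanced_odot u x : balanced_detail M u -> balanced_detail M (odot phi u x).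
Proof.
move=> /andP[ud] /eqP; case: u ud => w z ud sz; case: x => [[[c s] sg] gm].
have kP := @customer_choiceP _ _ _ phi _ c s sg gm ud.
have lP := @server_choiceP _ _ _ phi _ c s sg gm ud.
have /buffer_detailP d := ud; rewrite /odot.
move: kP lP => /=; rewrite !count_neq0.
case: hasP => [_ /(_ isT)[kw _]|nw _]; case: hasP => [_ /(_ isT)[lz _]|nz _].
- rewrite /balanced_detail !size_delete // sz eqxx andbT.
  by apply/buffer_detailP => i j /mem_delete iw /mem_delete; exact: d.
- rewrite /balanced_detail size_rcons size_delete // prednK ?(leq_ltn_trans _ kw) //.
  rewrite sz eqxx andbT; apply/buffer_detailP => i j /=.
  rewrite mem_rcons in_cons => /predU1P[->|/mem_delete iw]; last exact: d.
  by move=> jz; apply/negP => cj; apply: nz; exists j => //=; rewrite inE.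
- rewrite /balanced_detail size_rcons size_delete // prednK ?(leq_ltn_trans _ lz) //.
  rewrite sz eqxx andbT; apply/buffer_detailP => i j /= iw.
  rewrite mem_rcons in_cons => /predU1P[->|/mem_delete]; last exact: d.
  by apply/negP => cj; apply: nw; exists i => //=; rewrite inE.
case: ifPn => cs; first by rewrite /balanced_detail ud /= sz eqxx.
rewrite /balanced_detail !size_rcons sz eqxx andbT; apply/buffer_detailP => i j /=.
rewrite !mem_rcons !in_cons => /predU1P[->|iw] /predU1P[->|jz] //; last exact: d.
  by apply/negP => cj; apply: nz; exists j => //=; rewrite inE.
by apply/negP => cj; apply: nw; exists i => //=; rewrite inE.
Qed.

Lemma size_odot u x : balanced_detail M u ->
  size (odot phi u x).1 <= (size u.1).+1.
Proof.
move=> /andP[ud _]; case: u ud => w z ud; case: x => [[[c s] sg] gm].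
have := @customer_choiceP _ _ _ phi _ c s sg gm ud;
  rewrite /odot /=; case: eqP => [_ _|_ /(_ isT)[kw _]]; case: eqP => _ /=.
- by case: ifP => _ //=; rewrite size_rcons.
- by [].
- by rewrite size_rcons size_delete // prednK // (leq_ltn_trans _ kw).
by rewrite size_delete // leqW // leq_pred.
Qed.

Definition run (u : state) (w : seq (letter M)) : state := foldl (odot phi) u w.

Lemma run_cat u w1 w2 : run u (w1 ++ w2) = run (run u w1) w2.
Proof. exact: foldl_cat. Qed.

Lemma balanced_run u w : balanced_detail M u -> balanced_detail M (run u w).
Proof. by elim: w u => //= x w IH u ub; apply: IH; exact: balanced_odot. Qed.

Lemma size_run_empty w : size (run empty w).1 <= size w.
Proof.
elim/last_ind: w => // w x IH; rewrite size_rcons -cats1 run_cat.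
by rewrite (leq_trans (size_odot _ _)) // balanced_run // balanced_empty.
Qed.

Lemma Q_run (w : seq (letter M)) :
  Q phi [seq x.1.1.1 | x <- w] [seq x.1.1.2 | x <- w] [seq x.1.2 | x <- w]
    [seq x.2 | x <- w] = run empty w.
Proof.
rewrite /Q !zip_map; congr foldl; rewrite -[RHS]map_id.
by apply: eq_map => -[[[]]].
Qed.

(** A buffer detail stores no matching pair, so feeding its own letters column
by column triggers no match and rebuilds it, whatever the preferences. *)
Lemma run_detail w1 z1 w2 z2 sg gm :
  buffer_detail M (w1 ++ w2, z1 ++ z2) ->
  size z2 = size w2 -> size sg = size w2 -> size gm = size w2 ->
  run (w1, z1) (zip (zip (zip w2 z2) sg) gm) = (w1 ++ w2, z1 ++ z2).
Proof.
elim: w2 w1 z1 z2 sg gm => [|c w2 IH] w1 z1 [|s z2] [|a sg] [|b gm] // d.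
  by rewrite !cats0.
move=> [e1] [e2] [e3]; have /buffer_detailP /= D := d.
rewrite -!cat_rcons -(IH _ _ _ sg gm) ?cat_rcons // /run /= !count_neq0.
case: hasP => [[i iw]|_].
  rewrite !inE => si; have := D i s; rewrite si !mem_cat iw !in_cons eqxx !orbT.
  by move=> /(_ isT isT).
case: hasP => [[j jz]|_].
  rewrite !inE => si; have := D c j; rewrite si !mem_cat jz !in_cons eqxx !orbT.
  by move=> /(_ isT isT).
have := D c s; rewrite !mem_cat !in_cons !eqxx !orbT => /(_ isT isT) cs.
by rewrite (negbTE cs).
Qed.

(** Starting from a buffer detail amounts to starting from the empty state with
a longer input.  This is how sub-additivity and erasing couples, which speak of
inputs fed to the empty state, say something about arbitrary initial states. *)
Lemma Q_detail u sg gm w : balanced_detail M u ->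
  size sg = size u.1 -> size gm = size u.1 ->
  Q phi (u.1 ++ [seq x.1.1.1 | x <- w]) (u.2 ++ [seq x.1.1.2 | x <- w])
    (sg ++ [seq x.1.2 | x <- w]) (gm ++ [seq x.2 | x <- w]) = run u w.
Proof.
move=> ub e1 e2; have e3 := balanced_size ub; have e4 := Q_run w; move: e4.
rewrite /Q !zip_cat ?size_zip ?e1 ?e2 -?e3 ?minnn // !zip_map.
have -> : [seq (x.1.1.1, x.1.1.2, x.1.2, x.2) | x <- w] = w.
  by rewrite -[RHS]map_id; apply: eq_map => -[[[]]].
move=> _; rewrite foldl_cat; case: u ub e1 e2 e3 => [v z] /= /andP[ud _] e1 e2 e3.
by congr foldl; exact: (@run_detail [::] [::]).
Qed.

Definition default_cpref : customer_prefs M := [ffun=> 1%g].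
Definition default_spref : server_prefs M := [ffun=> 1%g].

(** Two chains driven by the same input stay comparable: the excess over the
chain started empty never exceeds the initial size. *)
Lemma size_run u w : sub_additive phi -> balanced_detail M u ->
  size (run u w).1 <= size u.1 + size (run empty w).1.
Proof.
move=> sub ub; set sg := nseq (size u.1) default_cpref.
set gm := nseq (size u.1) default_spref.
have e1 : size sg = size u.1 by rewrite size_nseq.
have e2 : size gm = size u.1 by rewrite size_nseq.
have e3 := balanced_size ub.
have [] := sub u.1 [seq x.1.1.1 | x <- w] u.2 [seq x.1.1.2 | x <- w] sg
  [seq x.1.2 | x <- w] gm [seq x.2 | x <- w].
1-6: by rewrite ?size_map // ?e1 ?e2 ?e3.
rewrite Q_detail // Q_run => H _; have := @Q_detail u sg gm [::] ub e1 e2.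
by move: H; rewrite /= !cats0 => H E; rewrite E in H.
Qed.

End Dynamics.

(** * Expectations over words of independent letters *)

Section Mean.
Local Open Scope ring_scope.
Variables (R : realFieldType) (A : finType) (p : A -> R).
Hypotheses (p_ge0 : forall x, 0 <= p x) (p_sum : \sum_x p x = 1).

(** Recursion on the length makes the Markov property at time one hold by
computation. *)
Fixpoint mean (n : nat) (f : seq A -> R) : R :=
  if n is n'.+1 then \sum_x p x * mean n' (fun w => f (x :: w)) else f [::].

Lemma eq_mean n f g : (forall w, size w = n -> f w = g w) -> mean n f = mean n g.
Proof.
elim: n f g => [|n IH] f g fg /=; first exact: fg.
by apply: eq_bigr => x _; congr (_ * _); apply: IH => w wn; apply: fg; rewrite /= wn.
Qed.

Lemma le_mean n f g : (forall w, size w = n -> f w <= g w) -> mean n f <= mean n g.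
Proof.
elim: n f g => [|n IH] f g fg /=; first exact: fg.
apply: ler_sum => x _; apply: ler_wpM2l => //; apply: IH => w wn.
by apply: fg; rewrite /= wn.
Qed.

Lemma meanD n f g : mean n (fun w => f w + g w) = mean n f + mean n g.
Proof.
elim: n f g => //= n IH f g; rewrite -big_split /=.
by apply: eq_bigr => x _; rewrite IH mulrDr.
Qed.

Lemma meanZr n f c : mean n (fun w => f w * c) = mean n f * c.
Proof.
elim: n f => //= n IH f; rewrite mulr_suml.
by apply: eq_bigr => x _; rewrite IH mulrA.
Qed.

Lemma mean_cst n c : mean n (fun=> c) = c.
Proof. by elim: n => //= n IH; rewrite IH -mulr_suml p_sum mul1r. Qed.

Lemma mean_sum n m (f : nat -> seq A -> R) :
  mean n (fun w => \sum_(k < m) f k w) = \sum_(k < m) mean n (f k).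
Proof.
elim: m => [|m IH].
  by rewrite big_ord0 -[RHS](mean_cst n); apply: eq_mean => w _; rewrite big_ord0.
rewrite big_ord_recr /= -IH -meanD; apply: eq_mean => w _.
by rewrite big_ord_recr.
Qed.

Lemma mean_cat m n f :
  mean (m + n)%N f = mean m (fun w1 => mean n (fun w2 => f (w1 ++ w2))).
Proof.
by elim: m f => //= m IH f; apply: eq_bigr => x _; rewrite IH.
Qed.

(** Used for an erasing word: its chance of showing up drives both the coupling
estimate and the positivity of the empty state. *)
Lemma mean_pred1 (v : seq A) :
  mean (size v) (fun w => (w == v)%:R) = \prod_(x <- v) p x.
Proof.
elim: v => [|y v IH] /=; first by rewrite big_nil.
rewrite big_cons (bigD1 y) //= big1 ?addr0 => [|x xy].
  by rewrite -IH; congr (_ * _); apply: eq_mean => w _; rewrite eqseq_cons eqxx.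
rewrite (@eq_mean _ _ (fun=> 0)) ?mean_cst ?mulr0 // => w _.
by rewrite eqseq_cons (negbTE xy).
Qed.

End Mean.

(** * Mean coupling time of a ball of states *)

Section Coupling.
Local Open Scope ring_scope.
Variables (R : realFieldType) (C S : finType) (M : matching_structure C S).
Variable phi : admissible_policy M.
Variable p : input M -> R.
Hypotheses (p_ge0 : forall x, 0 <= p x) (p_sum : \sum_x p x = 1).
Hypothesis sub : sub_additive phi.

Local Notation empty := (empty_state C S).

Definition feed (u : state C S) (w : seq (input M)) : state C S :=
  run phi u [seq letter_of x | x <- w].

Lemma feed_cat u w1 w2 : feed u (w1 ++ w2) = feed (feed u w1) w2.
Proof. by rewrite /feed map_cat run_cat. Qed.

Lemma balanced_feed u w : balanced_detail M u -> balanced_detail M (feed u w).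
Proof. exact: balanced_run. Qed.

Definition coupled (r : nat) (w : seq (input M)) : bool :=
  `[< forall u, balanced_detail M u -> (size u.1 <= r)%N ->
        feed u w = feed empty w >].

(** Time zero counts, unlike in [tau1], so that the hitting time below
vanishes at the empty state and satisfies the one-step equation elsewhere. *)
Fixpoint avoid (v : state C S) (w : seq (input M)) : bool :=
  (v != empty) &&
  (if w is x :: w' then avoid (odot phi v (letter_of x)) w' else true).

(** Mean time to reach the empty state from [v], truncated at [m]: the sum of
the tail probabilities. *)
Definition hitting_time (m : nat) (v : state C S) : R :=
  \sum_(n < m) mean p n (fun w => (avoid v w)%:R).

Lemma hitting_timeS m v : v != empty ->
  hitting_time m.+1 v = 1 + \sum_x p x * hitting_time m (odot phi v (letter_of x)).
Proof.
move=> vn; rewrite /hitting_time big_ord_recl /= vn; congr (_ + _).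
under [RHS]eq_bigr do rewrite mulr_sumr.
rewrite exchange_big; apply: eq_bigr => n _; apply: eq_bigr => x _.
by congr (_ * _); apply: eq_mean => w _ /=; rewrite vn.
Qed.

Lemma hitting_time_ge0 m v : 0 <= hitting_time m v.
Proof.
apply: sumr_ge0 => n _; rewrite -[X in X <= _](mean_cst p_sum n).
exact: le_mean.
Qed.

(** Mean time, truncated at [m], that remains before coupling once the word
[w0] has been read. *)
Definition uncoupled_time r m w0 : R :=
  \sum_(n < m) mean p n (fun w => (~~ coupled r (w0 ++ w))%:R).

Lemma uncoupled_timeS r m w0 :
  uncoupled_time r m.+1 w0 = (~~ coupled r w0)%:R +
    \sum_x p x * uncoupled_time r m (rcons w0 x).
Proof.
rewrite /uncoupled_time big_ord_recl /= cats0; congr (_ + _).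
under [RHS]eq_bigr do rewrite mulr_sumr.
rewrite exchange_big; apply: eq_bigr => n _; apply: eq_bigr => x _.
by congr (_ * _); apply: eq_mean => w _ /=; rewrite cat_rcons.
Qed.

Lemma le_uncoupled_time r m m' w0 : (m <= m')%N ->
  uncoupled_time r m w0 <= uncoupled_time r m' w0.
Proof.
move=> mm; rewrite /uncoupled_time -(subnKC mm) big_split_ord /= lerDl.
apply: sumr_ge0 => n _; rewrite -[X in X <= _](mean_cst p_sum (m + n)).
exact: le_mean.
Qed.

(** When [w0] brings the empty state back to itself, it maps the ball of radius
[r] into itself by sub-additivity, so coupling may start afresh after [w0]. *)
Lemma coupled_cat r w0 w : feed empty w0 = empty -> coupled r w ->
  coupled r (w0 ++ w).
Proof.
move=> w0e /asboolP cw; apply/asboolP => u ub ur; rewrite !feed_cat w0e cw //.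
  exact: balanced_feed.
rewrite (leq_trans _ ur) //; have := size_run [seq letter_of x | x <- w0] sub ub.
by move: w0e; rewrite /feed => ->; rewrite addn0.
Qed.

Lemma coupled_prefix r w w' : coupled r w -> coupled r (w ++ w').
Proof.
by move=> /asboolP cw; apply/asboolP => u ub ur; rewrite !feed_cat cw.
Qed.

(** Wait for the chain started empty to be empty again, then start afresh.  Away
from the empty state, a step contributes at most one to the left-hand side and
exactly one to the hitting time, so induction on the horizon replaces the strong
Markov property. *)
Lemma uncoupled_time_le_hitting_time r m w0 :
  uncoupled_time r m w0 <= hitting_time m (feed empty w0) + uncoupled_time r m [::].
Proof.
elim: m w0 => [|m IH] w0.
  by rewrite /uncoupled_time /hitting_time !big_ord0 addr0.
have [w0e|w0n] := eqVneq (feed empty w0) empty.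
  rewrite ler_wpDl ?hitting_time_ge0 //; apply: ler_sum => n _; apply: le_mean => // w _ /=.
  by rewrite ler_nat; case: (boolP (coupled r w)) => [/(coupled_cat w0e) ->|_] //;
    case: (coupled _ _).
rewrite uncoupled_timeS hitting_timeS // -addrA lerD //; first by case: (~~ _).
rewrite (le_trans _ (_ : \sum_x p x *
  (hitting_time m (odot phi (feed empty w0) (letter_of x)) + uncoupled_time r m [::]) <= _)) //.
  apply: ler_sum => x _; apply: ler_wpM2l => //; rewrite (le_trans (IH _)) //.
  by rewrite -cats1 feed_cat.
under eq_bigr do rewrite mulrDr.
by rewrite big_split /= -mulr_suml p_sum mul1r lerD2l le_uncoupled_time.
Qed.

(** Read a word of the length of the coupling word [e].  It is [e] itself with
probability [d], and then coupling has occurred; otherwise wait for the next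
return to the empty state and start afresh.  The truncated mean [a] thus
satisfies [a <= L + h + (1 - d) * a], where [h], the mean of the bounds on
hitting times, does not depend on the horizon. *)
Lemma uncoupled_time_bounded r (e : seq (input M)) :
  (forall v, balanced_detail M v -> exists b, forall m, hitting_time m v <= b) ->
  coupled r e -> 0 < \prod_(x <- e) p x ->
  exists b, forall m, uncoupled_time r m [::] <= b.
Proof.
move=> hit_b ce; set d := \prod_(x <- e) p x => d0; set L := size e.
have /choice[H HP] : forall v, exists b, balanced_detail M v ->
    forall m, hitting_time m v <= b.
  move=> v; have [/hit_b[b bP]|nv] := boolP (balanced_detail M v).
    by exists b.
  by exists 0.
have bal w : balanced_detail M (feed empty w) by exact/balanced_feed/balanced_empty.
exists ((L%:R + mean p L (fun w => H (feed empty w))) / d) => m.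
rewrite ler_pdivlMr //; set a := uncoupled_time r m [::].
have aL : a <= L%:R + mean p L (fun w => uncoupled_time r m w).
  rewrite (le_trans (le_uncoupled_time r _ (leq_addl L m))) //.
  rewrite /uncoupled_time big_split_ord /= lerD //.
    rewrite -[L in L%:R](card_ord L) -sumr_const; apply: ler_sum => i _ /=.
    rewrite -[X in _ <= X](mean_cst p_sum i); apply: le_mean => // w _.
    by case: (~~ _).
  rewrite (mean_sum p_sum L m (fun n w =>
    mean p n (fun v => (~~ coupled r (w ++ v))%:R))); apply: ler_sum => i _.
  by rewrite mean_cat.
(* Bound the remaining time word by word, isolating the word [e]. *)
have {}aL : a <= L%:R + (mean p L (fun w => H (feed empty w)) + (1 - d) * a).
  rewrite (le_trans aL) // lerD2l -[d](mean_pred1 p_sum) -/L.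
  rewrite -[X in X - _](mean_cst p_sum L) mulrBl -!meanZr.
  rewrite addrA -meanD lerBrDr -meanD; apply: le_mean => // w wL.
  have [->|_] := eqVneq; last first.
    by rewrite mul0r addr0 mul1r 
      (le_trans (uncoupled_time_le_hitting_time _ _ _)) // lerD2r HP.
  (* The word read is [e]: every later word is coupled. *)
  rewrite mul1r lerD2r (@le_trans _ _ 0) //; last first.
    exact: le_trans (hitting_time_ge0 0 _) (HP _ _ _).
  rewrite /uncoupled_time big1 // => n _.
  by rewrite -[RHS](mean_cst p_sum n); apply: eq_mean => v _; rewrite coupled_prefix.
by move: aL; set h := mean p L _; clearbody a h d; lra.
Qed.



End Coupling.

(** * Windows of the input sequence *)

Section Inputs.
Local Open Scope ring_scope.
Variables (C S : finType) (M : matching_structure C S).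
Local Notation Omega := (Omega M).
Local Notation input := (input M).

Fixpoint window (k : int) (n : nat) (om : Omega) : seq input :=
  if n is n'.+1 then om k :: window (k + 1) n' om else [::].

Lemma size_window k n om : size (window k n om) = n.
Proof. by elim: n k => //= n IH k; rewrite IH. Qed.

Lemma window_cat k m n om :
  window k (m + n) om = window k m om ++ window (k + m%:Z) n om.
Proof.
elim: m k => [|m IH] k; first by rewrite addr0.
by rewrite addSn /= IH -addrA [1 + _]addrC -PoszD addn1.
Qed.

Lemma window_shift k j n om :
  window k n (time_shift j om) = window (k + j) n om.
Proof. by elim: n k => //= n IH k; rewrite IH addrAC. Qed.

Definition cylinder (ns : seq int) (B : int -> set input) : set Omega :=
  [set om | forall n, n \in ns -> B n (om n)].

Lemma measurable_coord (n : int) (B : set input) :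
  measurable [set om : Omega | B (om n)].
Proof. by apply: sub_sigma_algebra; exists n, B. Qed.

Lemma cylinder_cons n ns B :
  cylinder (n :: ns) B = [set om | B n (om n)] `&` cylinder ns B.
Proof.
apply/seteqP; split => om /= H.
  by split=> [|i ins]; apply: H; rewrite in_cons ?eqxx ?ins ?orbT.
by move=> i; rewrite in_cons => /predU1P[->|]; [case: H|apply: H.2].
Qed.

Lemma measurable_cylinder ns B : measurable (cylinder ns B).
Proof.
elim: ns => [|n ns IH].
  by rewrite (_ : cylinder _ _ = setT) //; apply/seteqP; split.
by rewrite cylinder_cons; apply: measurableI => //; exact: measurable_coord.
Qed.

Lemma measurable_preimage (T : countType) (f : Omega -> T) :
  (forall x, measurable [set om | f om = x]) -> forall A, measurable (f @^-1` A).
Proof.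
move=> mf A; rewrite (_ : _ @^-1` _ =
    \bigcup_x ([set om | f om = x] `&` [set om | A x])); last first.
  apply/seteqP; split => [om Af|om [x _] [/= <-]] //.
  by exists (f om).
apply: countable_bigcupT_measurable => // x; apply: measurableI => //.
have [Ax|nAx] := pselect (A x).
  by rewrite (_ : mkset _ = setT) //; apply/seteqP; split.
by rewrite (_ : mkset _ = set0) //; apply/seteqP; split.
Qed.

Lemma measurable_window k n (A : set (seq input)) :
  measurable [set om | A (window k n om)].
Proof.
apply: (measurable_preimage (f := window k n)) => w.
elim: n k w => [|n IH] k [|x w] /=.
- by rewrite (_ : mkset _ = setT) //; apply/seteqP; split.
- by rewrite (_ : mkset _ = set0) //; apply/seteqP; split.
- by rewrite (_ : mkset _ = set0) //; apply/seteqP; split.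
rewrite (_ : mkset _ = [set om | om k = x] `&` [set om | window (k + 1) n om = w]).
  by apply: measurableI => //; exact: (measurable_coord k [set x]).
by apply/seteqP; split => om /= [] // -> ->.
Qed.

Lemma measurable_fun_time_shift k :
  measurable_fun setT (time_shift k : Omega -> Omega).
Proof.
refine (@measurability _ _ _ _ _ (time_shift k) (@cylinders C S M) _ _) => // _ [_ [n [B ->]] <-].
by rewrite setTI; exact: (measurable_coord (n + k)).
Qed.

Lemma measurable_time_shift k (A : set Omega) :
  measurable A -> measurable (time_shift k @^-1` A).
Proof.
by move=> mA; rewrite -[X in measurable X]setTI; exact: measurable_fun_time_shift.
Qed.

End Inputs.

(** * The law of an independent input *)

Section Law.
Variables (R : realType) (C S : finType) (M : matching_structure C S).
Variable P : probability (Omega M) R.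
Hypothesis P_iid : iid P.
Local Notation Omega := (Omega M).
Local Notation input := (input M).
Local Open Scope ring_scope.

Definition letter_prob (x : input) : R := fine (P [set om | om 0 = x]).

Lemma P_coord n x : P [set om : Omega | om n = x] = (letter_prob x)%:E.
Proof.
have [H _] := P_iid; have := H n [set x]; rewrite /= => ->.
rewrite /letter_prob fineK // fin_num_measure //.
exact: (measurable_coord 0 [set x]).
Qed.

Lemma letter_prob_ge0 x : 0 <= letter_prob x.
Proof. by rewrite -lee_fin -(P_coord 0). Qed.

Lemma measure_split (T : finType) (f : Omega -> T) (D : set Omega) :
  (forall x, measurable (D `&` [set om | f om = x])) ->
  P D = (\sum_(x : T) P (D `&` [set om | f om = x]))%E.
Proof.
move=> mD; rewrite -big_enum /= fsbig_seq ?enum_uniq // -measure_fin_bigcup //.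
- congr (P _); apply/seteqP; split => [om Dom|om [x _ []]] //.
  by exists (f om) => //=; rewrite mem_enum.
- by apply/trivIsetP => x y _ _ xy; apply/seteqP; split => om //= [[_ ->] [_ /eqP]];
    rewrite (negbTE xy).
Qed.

Lemma letter_prob_sum : \sum_x letter_prob x = 1.
Proof.
apply/EFin_inj; rewrite -sumEFin -(probability_setT P).
rewrite (@measure_split _ (fun om => om 0)).
  by apply: eq_bigr => x _; rewrite setTI P_coord.
by move=> x; rewrite setTI; exact: (measurable_coord 0 [set x]).
Qed.

Local Notation mean := (mean letter_prob).

(** The constraints on the coordinates [ns], all before the window, are carried
along so that induction can move the first letter of the window into them. *)
Lemma P_cylinder_window (ns : seq int) B k n (A : pred (seq input)) :
  uniq ns -> {in ns, forall j, j < k} ->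
  P (cylinder ns B `&` [set om | A (window k n om)]) =
  (P (cylinder ns B) * (mean n (fun w => (A w)%:R))%:E)%E.
Proof.
have mA j m (A' : pred (seq input)) : measurable [set om : Omega | A' (window j m om)].
  exact: (measurable_window j m A').
elim: n k ns B A => [|n IH] k ns B A uns nsk /=.
  case: (A [::]); last by rewrite mule0 (_ : _ `&` _ = set0) ?measure0 //;
    apply/seteqP; split=> [? []|].
  by rewrite mule1 (_ : _ `&` _ = cylinder ns B) //; apply/seteqP; split => om // [].
have kns : k \notin ns by apply/negP => /nsk; rewrite ltxx.
rewrite (@measure_split _ (fun om => om k)); last first.
  move=> x; apply: measurableI; last exact: (measurable_coord k [set x]).
  apply: measurableI; first exact: measurable_cylinder.
  exact: (mA k n.+1).
rewrite -sumEFin ge0_sume_distrr; last first.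
  move=> x _; rewrite lee_fin mulr_ge0 ?letter_prob_ge0 //.
  rewrite -[X in X <= _](mean_cst letter_prob_sum n).
  by apply: le_mean => //; exact: letter_prob_ge0.
apply: eq_bigr => x _; pose B' j := if j == k then [set x] else B j.
have B'E j : j \in ns -> B' j = B j.
  by rewrite /B'; case: eqP => // ->; rewrite (negbTE kns).
have B'k : B' k = [set x] by rewrite /B' eqxx.
(* The first letter [x] of the window becomes a constraint at time [k]. *)
transitivity (P (cylinder (k :: ns) B' `&`
    [set om | A (x :: window (k + 1) n om)])).
  congr (P _); rewrite cylinder_cons B'k.
  apply/seteqP; split => om /=.
    move=> [[Bom Aom] omk]; rewrite -omk; do 2 split => //.
    by move=> j jns; rewrite B'E //; exact: Bom.
  move=> [[omk Bom] Aom]; rewrite omk; do 2 split => //.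
  by move=> j jns; rewrite -B'E //; exact: Bom.
rewrite (IH (k + 1) (k :: ns) B' (fun w => A (x :: w))) /= ?kns //; last first.
  move=> j; rewrite in_cons => /predU1P[->|/nsk jk]; first by rewrite ltrDl.
  by rewrite (lt_trans jk) // ltrDl.
rewrite EFinM muleA; congr (_ * _)%E; have [_ indep] := P_iid.
rewrite /cylinder !indep //= ?kns // big_cons B'k muleC; congr (_ * _)%E.
  by apply: eq_big_seq => j /B'E ->.
exact: P_coord.
Qed.

Lemma P_window k n (A : pred (seq input)) :
  P [set om | A (window k n om)] = (mean n (fun w => (A w)%:R))%:E.
Proof.
have := @P_cylinder_window [::] (fun=> setT) k n A isT.
have -> : cylinder [::] (fun=> setT) = setT :> set Omega.
  by apply/seteqP; split=> om // _ j.
by rewrite setTI probability_setT mul1e => ->.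
Qed.

(** The sets generating the sigma-field constrain one coordinate and are not
stable under intersection; these form a pi-system that generates it too. *)
Definition cylinder_sets : set (set Omega) :=
  [set A | exists ns B, A = cylinder ns B].

Lemma cylinder_setsI : setI_closed cylinder_sets.
Proof.
move=> _ _ [ns1 [B1 ->]] [ns2 [B2 ->]].
exists (ns1 ++ ns2), (fun j => [set x | (j \in ns1 -> B1 j x) /\ (j \in ns2 -> B2 j x)]).
apply/seteqP; split => om /=.
  by move=> [H1 H2] j _; split=> jn; [exact: H1|exact: H2].
by move=> H; split=> j jn; have := H j; rewrite mem_cat jn ?orbT => /(_ isT)[H1 H2]; auto.
Qed.

Lemma P_cylinder_shift k ns B :
  P (time_shift k @^-1` cylinder ns B) = P (cylinder ns B).
Proof.
have -> : time_shift k @^-1` cylinder ns B =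
    cylinder [seq j + k | j <- undup ns] (fun j => B (j - k)).
  apply/seteqP; split => om /= H j.
    move=> /mapP[i]; rewrite mem_undup => /H Bi ->; rewrite addrK.
    exact: Bi.
  by move=> jns; have := H (j + k); rewrite addrK; apply; apply: map_f; rewrite mem_undup.
have -> : cylinder ns B = cylinder (undup ns) B.
  by apply/seteqP; split => om H j jns; apply: H; move: jns; rewrite mem_undup.
have [stat indep] := P_iid; have uns := undup_uniq ns.
have unsk : uniq [seq j + k | j <- undup ns].
  by rewrite map_inj_uniq //; exact: addIr.
rewrite /cylinder (indep _ _ uns) (indep _ (fun j => B (j - k)) unsk).
by rewrite big_map; apply: eq_bigr => j _; rewrite addrK stat [in RHS]stat.
Qed.

(** The shifted law is another probability that agrees with [P] on a generating
pi-system. *)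
Lemma P_shift k (A : set Omega) : measurable A -> P (time_shift k @^-1` A) = P A.
Proof.
move=> mA; rewrite -[LHS]/(pushforward P (time_shift k) A).
apply: (measure_unique cylinder_sets (fun=> setT)) => //.
- apply/seteqP; split.
    apply: smallest_sub; first exact: smallest_sigma_algebra.
    move=> _ [n [B ->]]; apply: sub_sigma_algebra; exists [:: n], (fun=> B).
    by apply/seteqP; split => om /= H; [move=> j /[!inE] /eqP ->|apply: H; rewrite inE].
  apply: smallest_sub; first exact: sigma_algebra_measurable.
  by move=> _ [ns [B ->]]; exact: measurable_cylinder.
- exact: cylinder_setsI.
- by move=> _; exists [::], (fun=> setT); apply/seteqP; split=> om // _ j.
- by apply/seteqP; split => // om _; exists 0%N.
- exact: measurable_fun_time_shift.
- by move=> ? _ [ns [B ->]]; exact: P_cylinder_shift.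
- move=> ? _; rewrite (@le_lt_trans _ _ 1%E) ?ltry //.
  by rewrite /= /pushforward preimage_setT probability_setT.
Qed.

Lemma ae_shift k (Q : Omega -> Prop) :
  {ae P, forall om, Q om} -> {ae P, forall om, Q (time_shift k om)}.
Proof.
move=> [N [mN N0 subN]]; exists (time_shift k @^-1` N); split.
- exact: measurable_time_shift.
- by rewrite P_shift.
- by move=> om /= nQ; apply: subN.
Qed.

End Law.

(** * Almost sure coupling from the past *)

Section Chain.
Local Open Scope ring_scope.
Variables (R : realType) (C S : finType) (M : matching_structure C S).
Variable P : probability (Omega M) R.
Variable phi : admissible_policy M.
Hypothesis P_iid : iid P.
Hypothesis tau_int : forall V : Omega M -> state C S, Vinfty P V ->
  P.-integrable setT (tau1 R phi V).
Local Notation Omega := (Omega M).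
Local Notation input := (input M).
Local Notation empty := (empty_state C S).
Local Notation p := (letter_prob P).
Local Notation mean := (mean p).
Local Notation feed := (feed phi).

Lemma recurE V n (om : Omega) : recur phi V n om = feed (V om) (window 0 n om).
Proof.
elim: n => //= n ->; have -> : om 0 :: window (0 + 1) n om = window 0 n.+1 om by [].
by rewrite -addn1 window_cat feed_cat.
Qed.

Lemma recur_past V n (om : Omega) :
  recur phi V n (time_shift (- n%:Z) om) =
  feed (V (time_shift (- n%:Z) om)) (window (- n%:Z) n om).
Proof. by rewrite recurE window_shift add0r. Qed.

Lemma Vinfty_cst u : balanced_detail M u -> Vinfty P (fun=> u).
Proof.
move=> ub; exists (size u.1).+1 => //; split.
  split=> [//|A]; have [Au|nAu] := pselect (A u).
    by rewrite (_ : _ @^-1` _ = setT) //; apply/seteqP; split.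
  by rewrite (_ : _ @^-1` _ = set0) //; apply/seteqP; split.
by apply: aeW => om; rewrite -(balanced_size ub); split => //; exact: leqnSn.
Qed.

Lemma avoid_take v w k : avoid phi v w -> (k <= size w)%N -> feed v (take k w) != empty.
Proof.
elim: w v k => [|x w IH] v [|k] //=; [by rewrite andbT|by case/andP|].
by case/andP => _ /IH; exact.
Qed.

Lemma sum_ltn_le m n : (\sum_(j < m) (j < n)%N <= n)%N.
Proof.
suff -> : (\sum_(j < m) (j < n)%N = minn m n)%N by exact: geq_minr.
elim: m => [|m IH]; first by rewrite big_ord0 min0n.
by rewrite big_ord_recr /= IH; lia.
Qed.

(** The number of [j < m] such that the empty state has not been visited by time
[j] is at most any time [n > 0] of visit. *)
Lemma avoid_time_le_tau1 v m (om : Omega) :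
  (\sum_(j < m) ((avoid phi v (window 0 j om))%:R : R)%:E <=
   tau1 R phi (fun=> v) om)%E.
Proof.
apply: le_ereal_inf_tmp => _ [n [n0 rn] <-]; rewrite sumEFin lee_fin.
rewrite (@le_trans _ _ (\sum_(j < m) (j < n)%N)%:R) ?ler_nat ?sum_ltn_le //.
rewrite natr_sum; apply: ler_sum => j _; rewrite ler_nat.
case: ltnP => [_|nj]; first by case: avoid.
case: (boolP (avoid _ _ _)) => // /avoid_take - /(_ n); rewrite size_window nj.
move=> /(_ isT); rewrite -(subnKC nj) window_cat take_size_cat ?size_window //.
by move: rn; rewrite recurE => ->; rewrite eqxx.
Qed.

(** The tail probabilities sum up to the integral of a function bounded by
[tau1], for a constant initial state. *)
Lemma hitting_time_bounded v : balanced_detail M v ->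
  exists b, forall m, hitting_time phi p m v <= b.
Proof.
move=> vb; have iv := tau_int (Vinfty_cst vb).
exists (fine (\int[P]_om tau1 R phi (fun=> v) om)%E) => m.
rewrite -lee_fin fineK ?integrable_fin_num // /hitting_time -sumEFin.
pose A j := [set om : Omega | avoid phi v (window 0 j om)].
have mA j : measurable (A j) by exact: (measurable_window 0 j (avoid phi v)).
have mI j : measurable_fun setT (EFin \o \1_(A j) : Omega -> \bar R).
  by apply/measurable_EFinP; exact: measurable_indic.
under eq_bigr => j _ do
  rewrite -(P_window P_iid 0) -/(A j) -[A j]setIT -integral_indic //.
rewrite -ge0_integral_sum //; last by move=> j; exact: mI.
apply: ge0_le_integral => //.
- by move=> om _; apply: sume_ge0 => j _; rewrite lee_fin.
- by apply: emeasurable_sum => j; exact: mI.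
- exact: measurable_int iv.
move=> om _; rewrite (le_trans _ (avoid_time_le_tau1 v m om)) //.
apply: lee_sum => j _; rewrite lee_fin indicE ler_nat.
by case: (boolP (om \in A j)) => //; rewrite inE /A /= => ->.
Qed.

Hypothesis phi_sub : sub_additive phi.
Hypothesis P_support : full_support P.
Hypothesis erasing : forall u : state C S, balanced_detail M u ->
  exists c s, erasing_couple phi u c s.

Lemma positive_input (a : arrival M) : exists x : input, x.1.1 = a /\ 0 < p x.
Proof.
apply: contrapT => H; have := P_support a.
rewrite (@measure_split _ _ _ _ P _ (fun om : Omega => om 0)); last first.
  move=> x; apply: measurableI; last exact: (measurable_coord 0 [set x]).
  exact: (measurable_coord 0 [set x | x.1.1 = a]).
rewrite big1 ?ltxx // => x _; have [xa|xa] := eqVneq x.1.1 a; last first.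
  rewrite (_ : _ `&` _ = set0) ?measure0 //; apply/seteqP; split => // om /= [].
  by move=> + xE; rewrite /input0 xE => /eqP; rewrite (negbTE xa).
have P0 : P [set om : Omega | om 0 = x] = 0%E.
  rewrite P_coord //; congr EFin; apply/eqP; rewrite eq_le (letter_prob_ge0 P_iid) andbT leNgt.
  by apply/negP => px; apply: H; exists x.
apply: (subset_measure0 (B := [set om : Omega | om 0 = x])).
- apply: measurableI; last exact: (measurable_coord 0 [set x]).
  exact: (measurable_coord 0 [set x | x.1.1 = a]).
- exact: (measurable_coord 0 [set x]).
- by move=> om [].
exact: P0.
Qed.

(** The support hypothesis only concerns the classes of the entering couples;
erasing couples act whatever the preferences, so any preferences that have
positive probability together with the prescribed couples will do. *)
Lemma positive_word (cs : seq (C * S)) : {subset cs <= arrivals M} ->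
  exists e : seq input, [seq val x.1.1 | x <- e] = cs /\ 0 < \prod_(x <- e) p x.
Proof.
elim: cs => [|c cs IH] F; first by exists [::]; rewrite big_nil ltr01.
have [|e [ecs pe]] := IH; first by move=> y ycs; apply: F; rewrite in_cons ycs orbT.
have [x [xc px]] := positive_input (exist _ c (F c (mem_head _ _))).
by exists (x :: e); rewrite /= xc ecs big_cons mulr_gt0.
Qed.

Lemma erasing_word u : balanced_detail M u ->
  exists e, [/\ 0 < \prod_(x <- e) p x, feed empty e = empty & feed u e = empty].
Proof.
move=> ub; have [c [s [[sc F] H]]] := erasing ub.
have [e [ecs pe]] := positive_word F; pose w := [seq letter_of x | x <- e].
have wc : [seq x.1.1.1 | x <- w] = c.
  transitivity (unzip1 (zip c s)); last by rewrite unzip1_zip ?sc.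
  by rewrite -ecs /unzip1 -!map_comp.
have ws : [seq x.1.1.2 | x <- w] = s.
  transitivity (unzip2 (zip c s)); last by rewrite unzip2_zip ?sc.
  by rewrite -ecs /unzip2 -!map_comp.
have [||||] := H (nseq (size u.1) (default_cpref M)) [seq x.1.2 | x <- w]
  (nseq (size u.1) (default_spref M)) [seq x.2 | x <- w].
1-4: by rewrite ?size_nseq // -wc !size_map.
by rewrite -wc -ws Q_run Q_detail ?size_nseq // => He Hu; exists e.
Qed.

(** Erase the states one after the other: once a word is chosen for the first
ones, append an erasing word of the state that it leads the next one to.  Since
each word fixes the empty state, states already erased remain so. *)
Lemma common_erasing_word (us : seq (state C S)) : all (balanced_detail M) us ->
  exists e, [/\ 0 < \prod_(x <- e) p x, feed empty e = empty &
    {in us, forall u, feed u e = empty}].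
Proof.
elim: us => [_|u us IH /= /andP[ub usb]]; first by exists [::]; rewrite big_nil ltr01.
have [e [pe ee eus]] := IH usb.
have [e' [pe' ee' eu]] := erasing_word (balanced_feed phi e ub).
exists (e ++ e'); rewrite big_cat mulr_gt0 //= !feed_cat ee; split=> // v.
by rewrite in_cons feed_cat => /predU1P[->//|/eus ->].
Qed.

Lemma short_words (A : finType) r :
  exists ws : seq (seq A), forall w : seq A, (size w <= r)%N -> w \in ws.
Proof.
elim: r => [|r [ws H]]; first by exists [:: [::]] => -[].
exists ([::] :: [seq x :: w | x <- enum A, w <- ws]) => -[//|x w] wr.
by rewrite in_cons /=; apply: allpairs_f; [rewrite mem_enum | exact: H].
Qed.

(** The ball of radius [r] is finite. *)
Lemma coupling_word r :
  exists e, [/\ 0 < \prod_(x <- e) p x, coupled phi r e & forall u,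
    balanced_detail M u -> (size u.1 <= r)%N -> feed u e = empty].
Proof.
have [ws wsP] := short_words C r; have [zs zsP] := short_words S r.
pose us := [seq u <- [seq (w, z) | w <- ws, z <- zs] | balanced_detail M u].
have [|e [pe ee H]] := @common_erasing_word us; first exact: filter_all.
have er u : balanced_detail M u -> (size u.1 <= r)%N -> feed u e = empty.
  move=> ub ur; apply: H; rewrite mem_filter ub; case: u ub ur => w z wzb wr.
  by apply: allpairs_f; [exact: wsP|apply: zsP; rewrite -(balanced_size wzb)].
by exists e; split=> //; apply/asboolP => u ub ur; rewrite er.
Qed.

(** The window of length [n] ending at time zero has the law of the first [n]
letters, so the probabilities of its not being coupled sum up to the mean
coupling time; Borel-Cantelli concludes. *)
Lemma ae_eventually_coupled r : {ae P, forall om, exists N, forall n, (N <= n)%N ->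
  coupled phi r (window (- n%:Z) n om)}.
Proof.
pose F n := [set om : Omega | ~~ coupled phi r (window (- n%:Z) n om)].
have mF n : measurable (F n).
  exact: (measurable_window (- n%:Z) n (fun w => ~~ coupled phi r w)).
have [e [pe ce _]] := coupling_word r.
have [b bP] := uncoupled_time_bounded (letter_prob_ge0 P_iid) (letter_prob_sum P_iid)
  phi_sub hitting_time_bounded ce pe.
exists (lim_sup_set F); split.
- by apply: bigcapT_measurable => n; exact: bigcup_measurable.
- apply: lim_sup_set_cvg0 => //; rewrite (@le_lt_trans _ _ b%:E) ?ltry //.
  apply: lime_le; first exact: is_cvg_nneseries.
  apply: nearW => m; rewrite (le_trans _ (_ : (uncoupled_time phi p r m [::])%:E <= _)%E)
    ?lee_fin //.
  rewrite /uncoupled_time -sumEFin big_mkord; apply: lee_sum => n _.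
  by rewrite -(P_window P_iid (- n%:Z)).
move=> om /= H n _; apply: contrapT => nH; apply: H; exists n => k nk.
by apply: contrapT => /negP ck; apply: nH; exists k.
Qed.

End Chain.

(** * Recurrence under the shift *)

Section Recurrence.
Local Open Scope ring_scope.
Variables (R : realType) (C S : finType) (M : matching_structure C S).
Variable P : probability (Omega M) R.
Hypothesis P_iid : iid P.
Local Notation Omega := (Omega M).

Lemma P_nonincreasing_small (F : nat -> set Omega) : (forall n, measurable (F n)) ->
  nonincreasing_seq F -> P (\bigcap_n F n) = 0%E ->
  forall eps : R, 0 < eps -> exists n, (P (F n) < eps%:E)%E.
Proof.
move=> mF dF F0 eps eps0.
have H : P (F n) @[n --> \oo] --> P (\bigcap_n F n).
  apply: nonincreasing_cvg_mu => //; last exact: bigcapT_measurable.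
  by rewrite (le_lt_trans (probability_le1 _ _)) ?ltry.
rewrite F0 in H; move/fine_cvgP: H => [_ /cvgrPdist_lt /(_ _ eps0) [n _ /(_ n (leqnn n))]].
rewrite /= sub0r normrN ger0_norm ?fine_ge0 // => h.
by exists n; rewrite -lte_fin fineK ?fin_num_measure in h.
Qed.

(** If [f] eventually exceeds [k] along the past orbit with probability more
than [q], then by invariance [f] itself exceeds [k] with probability at least
[q]; as [f] is finite, it cannot tend to infinity along the past orbit on a set
of positive probability. *)
Lemma ae_recurrent (f : Omega -> nat) : (forall k, measurable [set om | (k < f om)%N]) ->
  {ae P, forall om, exists K, forall N, exists2 n, (N <= n)%N &
    (f (time_shift (- n%:Z) om) <= K)%N}.
Proof.
move=> mf; pose F k := [set om | (k < f om)%N].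
pose B k n : set Omega := time_shift (- n%:Z) @^-1` F k.
have mB k n : measurable (B k n) by apply: measurable_time_shift; exact: mf.
pose L k := \bigcup_N \bigcap_(n >= N) B k n.
have mI k N : measurable (\bigcap_(n >= N) B k n).
  by apply: bigcap_measurable => //; exists N => /=.
have mL k : measurable (L k) by exact: bigcupT_measurable.
(* [L k]: [f] eventually exceeds [k] along the past orbit. *)
have LF k : (P (L k) <= P (F k))%E.
  have cL : P (\bigcap_(n >= N) B k n) @[N --> \oo] --> P (L k).
    apply: nondecreasing_cvg_mu; [exact: mI k|exact: mL k|] => m n mn.
    apply/subsetPset => om H j nj; apply: H.
    exact: leq_trans mn nj.
  rewrite -(cvg_lim _ cL) //; apply: lime_le; first by apply/cvg_ex; exists (P (L k)).
  apply: nearW => N; rewrite -(P_shift P_iid (- N%:Z) (mf k)).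
  by apply: le_measure; rewrite ?inE; [exact: mI|exact: mB|move=> om; apply => /=].
exists (\bigcap_k L k); split.
- exact: bigcapT_measurable.
- apply/eqP; rewrite eq_le measure_ge0 andbT leNgt; apply/negP => L0.
  have e0 : 0 < fine (P (\bigcap_k L k)).
    by rewrite fine_gt0 // L0 (le_lt_trans (probability_le1 _ _)) ?ltry //;
      exact: bigcapT_measurable.
  have [|||n] := P_nonincreasing_small (F := F) _ _ _ e0.
  + exact: mf.
  + by move=> m n mn; apply/subsetPset => om; exact: leq_ltn_trans.
  + rewrite (_ : \bigcap_k _ = set0) ?measure0 //; apply/seteqP; split=> // om.
    by move=> /(_ (f om) I); rewrite /F /= ltnn.
  rewrite fineK ?fin_num_measure //; last exact: bigcapT_measurable.
  rewrite ltNge => /negP; apply; rewrite (le_trans _ (LF n)) //.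
  apply: le_measure; rewrite ?inE; [exact: bigcapT_measurable|exact: mL|].
  by move=> om; exact.
move=> om /= H K _; apply: contrapT => nL; apply: H; exists K => N.
apply: contrapT => nN; apply: nL; exists N => // n /= Nn; rewrite /B /F /= ltnNge.
by apply/negP => fK; apply: nN; exists n.
Qed.

End Recurrence.

(** * The stationary solution *)

Section Limit.
Local Open Scope ring_scope.
Variables (R : realType) (C S : finType) (M : matching_structure C S).
Variable P : probability (Omega M) R.
Variable phi : admissible_policy M.
Hypothesis phi_sub : sub_additive phi.
Hypothesis erasing : forall u : state C S, balanced_detail M u ->
  exists c s, erasing_couple phi u c s.
Hypothesis P_iid : iid P.
Hypothesis P_support : full_support P.
Hypothesis tau_int : forall V : Omega M -> state C S, Vinfty P V ->
  P.-integrable setT (tau1 R phi V).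
Local Notation Omega := (Omega M).
Local Notation input := (input M).
Local Notation empty := (empty_state C S).
Local Notation p := (letter_prob P).
Local Notation mean := (mean p).
Local Notation feed := (feed phi).

Let ae_coupled := ae_eventually_coupled P_iid tau_int phi_sub P_support erasing.

(** State at time zero of the chain started empty at time [- n]. *)
Definition past_state (n : nat) (om : Omega) : state C S :=
  feed empty (window (- n%:Z) n om).

Lemma balanced_past n om : balanced_detail M (past_state n om).
Proof. exact/balanced_feed/balanced_empty. Qed.

Lemma window_pastS n (om : Omega) :
  window (- n.+1%:Z) n.+1 om = om (- n.+1%:Z) :: window (- n%:Z) n om.
Proof. by rewrite /= -addn1 PoszD opprD addrNK. Qed.

Definition coupled_from (N : nat) : set Omega :=
  \bigcap_(n >= N) [set om | coupled phi 1 (window (- n%:Z) n om)].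

Lemma measurable_coupled_from N : measurable (coupled_from N).
Proof.
apply: bigcap_measurable; first by exists N => /=.
by move=> n _; exact: (measurable_window (- n%:Z) n (fun w => coupled phi 1 w)).
Qed.

(** The chain started empty at time [- (n + 1)] is at time [- n] in the ball of
radius 1, hence merges with the chain started empty at time [- n]. *)
Lemma past_state_stable N om : coupled_from N om ->
  forall n, (N <= n)%N -> past_state n om = past_state N om.
Proof.
move=> H n /subnKC <-; elim: (n - N)%N => [|k <-]; first by rewrite addn0.
rewrite addnS /past_state window_pastS /=.
have /asboolP := H (N + k)%N (leq_addr _ _); apply.
  exact/balanced_odot/balanced_empty.
exact/size_odot/balanced_empty.
Qed.

(** The default value makes the solution a balanced state everywhere, also on
the null set where the past states do not stabilise. *)
Definition past_limit (om : Omega) : state C S :=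
  xget empty [set u | exists N, forall n, (N <= n)%N -> past_state n om = u].

Lemma past_limitE N u om :
  (forall n, (N <= n)%N -> past_state n om = u) -> past_limit om = u.
Proof.
move=> Hu; rewrite /past_limit; case: xgetP => [v _ [N' Hv]|]; last first.
  by move=> /(_ u); case; exists N.
by rewrite -(Hv (maxn N N')) ?leq_maxr // Hu ?leq_maxl.
Qed.

Lemma ae_coupled_from : {ae P, forall om, exists N, coupled_from N om}.
Proof. exact: ae_coupled. Qed.

Lemma ae_past_limit :
  {ae P, forall om, exists N, forall n, (N <= n)%N -> past_state n om = past_limit om}.
Proof.
apply: filterS ae_coupled_from => om [N cN]; exists N => n Nn.
by rewrite (past_limitE (past_state_stable cN)) (past_state_stable cN).
Qed.

Lemma balanced_past_limit : balanced_rv past_limit.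
Proof.
split=> [om|].
  rewrite /past_limit; case: xgetP => [v _ [N HN]|_]; last exact: balanced_empty.
  by rewrite -(HN N (leqnn N)); exact: balanced_past.
pose E u := \bigcup_N \bigcap_(n >= N) [set om | past_state n om = u].
have mE u : measurable (E u).
  apply: bigcupT_measurable => N; apply: bigcap_measurable; first by exists N => /=.
  move=> n _; exact: (measurable_window (- n%:Z) n [set w | feed empty w = u]).
have EP u om : E u om <-> exists N, forall n, (N <= n)%N -> past_state n om = u.
  by split=> [[N _ H]|[N H]]; exists N.
have limE u : u != empty -> [set om | past_limit om = u] = E u.
  move=> un; apply/seteqP; split => om; last by move=> /EP[N /past_limitE].
  rewrite /= /past_limit; case: xgetP => [v _ vP <-|_ ue]; first exact/EP.
  by rewrite ue eqxx in un.
apply: measurable_preimage => u; have [->|un] := eqVneq u empty; last by rewrite limE.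
rewrite (_ : mkset _ = ~` \bigcup_(v in [set v | v != empty]) E v).
  apply: measurableC; rewrite bigcup_mkcond; apply: countable_bigcupT_measurable.
    exact: countableP.
  by move=> v; case: ifP => _; [exact: mE|exact: measurable0].
apply/seteqP; split => om /=.
  by move=> le [v vn]; rewrite -limE //= le => ve; move: vn; rewrite /= -ve eqxx.
apply: contra_notP => /eqP ln; exists (past_limit om) => //.
by rewrite -limE.
Qed.

(** Seen from time one, a start at time [- n] is a start [n + 1] steps ago. *)
Lemma past_stateS n (om : Omega) :
  past_state n.+1 (time_shift 1 om) =
  odot phi (past_state n om) (letter_of (input0 om)).
Proof.
rewrite /past_state window_shift (_ : - n.+1%:Z + 1 = - n%:Z); last lia.
by rewrite -addn1 window_cat feed_cat addNr.
Qed.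

Lemma past_limit_stationary : stationary_solution P phi past_limit.
Proof.
apply: filterS ae_past_limit => om [N H]; apply: (@past_limitE N.+1) => -[//|n] Nn.
by rewrite past_stateS H.
Qed.

(** Invariance of [P] puts the initial values taken at all past times in a
single ball almost surely, and the windows eventually couple that ball. *)
Lemma strong_coupling V : Vinfty P V -> strong_backwards_coupling P phi V past_limit.
Proof.
move=> [r _ [[Vb _] Vr]].
have Vrn : {ae P, forall om, forall n : nat, (size (V (time_shift (- n%:Z) om)).1 <= r)%N}.
  apply: ae_foralln => n.
  by have := ae_shift P_iid (- n%:Z) Vr; apply: filterS => om [->].
move: Vrn ae_past_limit (ae_coupled r); apply: filterS3 => om Vrn [N1 H1] [N2 H2].
exists (maxn N1 N2) => n; rewrite geq_max => /andP[N1n N2n].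
by rewrite recur_past -(H1 n N1n); have /asboolP := H2 n N2n; apply.
Qed.

Lemma stationary_past U : stationary_solution P phi U ->
  {ae P, forall om, forall n : nat,
    U om = feed (U (time_shift (- n%:Z) om)) (window (- n%:Z) n om)}.
Proof.
move=> Us; have : {ae P, forall om, forall n : nat, U (time_shift (- n%:Z) om) =
    odot phi (U (time_shift (- n.+1%:Z) om)) (letter_of (om (- n.+1%:Z)))}.
  apply: ae_foralln => n; have := ae_shift P_iid (- n.+1%:Z) Us.
  apply: filterS => om; rewrite /input0 [time_shift _ om 0]/time_shift add0r => <-.
  congr U; apply/funext => k; rewrite /time_shift; congr om; lia.
apply: filterS => om H; elim=> [|n IH].
  rewrite /=; congr U; apply/funext => k; rewrite /time_shift; congr om; lia.
by rewrite window_pastS [LHS]IH H.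
Qed.

(** A stationary solution [U] follows the chain started from its own past
values.  By recurrence these lie infinitely often below some level [K]; there
they agree with the truncation of [U] at [K], which is a bounded initial
value and couples with the limit. *)
Lemma stationary_unique U : balanced_rv U -> stationary_solution P phi U ->
  {ae P, forall om, U om = past_limit om}.
Proof.
move=> [Ub mU] Us; pose V K om := if (size (U om).1 <= K)%N then U om else empty.
have VK K : Vinfty P (V K).
  have Vb om : balanced_detail M (V K om).
    by rewrite /V; case: ifP => _; [exact: Ub|exact: balanced_empty].
  exists K.+1 => //; split.
    split=> // A; have := mU ([set u | A (if (size u.1 <= K)%N then u else empty)]).
    by [].
  apply: aeW => om; rewrite -(balanced_size (Vb om)); split => //; rewrite leqW //.
  by rewrite /V; case: ifP.
have rec := ae_recurrent P_iid (f := fun om => size (U om).1)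
  (fun k => mU [set u | (k < size u.1)%N]).
have cpl := ae_foralln (fun K => strong_coupling (VK K)).
move: (stationary_past Us) rec cpl; apply: filterS3 => om UP [K HK] HN.
have [N {}HN] := HN K; have [n Nn nK] := HK N.
by rewrite -(HN n Nn) recur_past (UP n) /V nK.
Qed.

Lemma P_uncoupled_small (eps : R) : 0 < eps ->
  exists N, (P (~` coupled_from N) < eps%:E)%E.
Proof.
have mc := measurable_coupled_from.
apply: P_nonincreasing_small => [n|m n mn|]; first exact: measurableC.
  apply/subsetPset; apply: subsetC => om H j /= jm; apply: H.
  exact: leq_trans mn jm.
have mI : measurable (\bigcap_N ~` coupled_from N).
  by apply: bigcapT_measurable => N; exact: measurableC.
have [Z [mZ Z0 subZ]] := ae_coupled_from.
apply/eqP; rewrite eq_le measure_ge0 andbT -Z0.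
apply: le_measure; rewrite ?inE //; apply: subset_trans subZ.
by move=> om H [N cN]; exact: (H N I).
Qed.

(** Past windows that are coupled from [r] on give states of size at most [r],
the size being bounded by the number of letters read.  This happens with
probability at least 1/2, and the coupling word for radius [r] then empties the
buffer.  The resulting lower bound [d / 2] is uniform in the length of the
window, whereas past states differ from their limit with a probability that can
be made smaller than [d / 4]. *)
Lemma P_past_limit_empty : (0 < P [set om | past_limit om = empty])%E.
Proof.
have mc := measurable_coupled_from.
have mG n (A : set (state C S)) : measurable [set om | A (past_state n om)].
  exact: (measurable_window (- n%:Z) n [set w | A (feed empty w)]).
have half0 : 0 < 2^-1 :> R by rewrite invr_gt0.
have [r rP] := P_uncoupled_small half0.
pose small n := mean n (fun w => (size (feed empty w).1 <= r)%N%:R).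
have small_half n : (r <= n)%N -> 2^-1 <= small n.
  move=> rn; rewrite -lee_fin -(P_window P_iid (- n%:Z)).
  rewrite (@le_trans _ _ (P (coupled_from r))) //.
    have := probability_setC P (mc r); rewrite -(fineK (fin_num_measure P _ (mc r))).
    move=> E; move: rP; rewrite E -EFinD lte_fin lee_fin; lra.
  apply: le_measure; rewrite ?inE //; first exact: (mG n [set u | (size u.1 <= r)%N]).
  move=> om cr /=; have := past_state_stable cr rn; rewrite /past_state => ->.
  rewrite (leq_trans (size_run_empty _ _)) // size_map size_window //.
have [e [d0 _ eP]] := coupling_word P_iid P_support erasing r.
set d := \prod_(x <- e) p x in d0; set L := size e.
have d40 : 0 < d / 4 by rewrite divr_gt0.
have [N1 N1P] := P_uncoupled_small d40.
pose N := maxn r N1; have Ge : ((d / 2)%:E <=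
    P [set om | past_state (N + L) om = empty])%E.
  have -> : [set om | past_state (N + L) om = empty] =
      [set om | feed empty (window (- (N + L)%N%:Z) (N + L) om) == empty].
    by apply/seteqP; split => om /= /eqP.
  rewrite (P_window P_iid _ _ (fun w => feed empty w == empty)) lee_fin mean_cat.
  (* The first [N] letters lead into the ball, the last [L] letters spell [e]. *)
  rewrite (@le_trans _ _ (small N * d)) //.
    by rewrite mulrC ler_pM2r // small_half // leq_maxl.
  rewrite -meanZr; apply: (le_mean (letter_prob_ge0 P_iid)) => w _.
  rewrite -[d](mean_pred1 (letter_prob_sum P_iid)) -/L; case: leqP => wr; last first.
    rewrite mul0r -[X in X <= _](mean_cst (letter_prob_sum P_iid) L).
    by apply: (le_mean (letter_prob_ge0 P_iid)).
  rewrite mul1r; apply: (le_mean (letter_prob_ge0 P_iid)) => v _.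
  rewrite ler_nat feed_cat; case: eqP => // ->.
  by rewrite eP ?eqxx //; exact/balanced_feed/balanced_empty.
have mU : measurable [set om | past_limit om = empty].
  by have [_ m] := balanced_past_limit; exact: (m [set empty]).
rewrite ltNge; apply/negP => U0.
have : (P [set om | past_state (N + L) om = empty] <= P (~` coupled_from N1))%E.
  rewrite (@le_trans _ _ (P ([set om | past_limit om = empty] `|` ~` coupled_from N1))) //.
    apply: le_measure; rewrite ?inE //; first exact: (mG _ [set empty]).
      by apply: measurableU => //; exact: measurableC.
    move=> om /= Gem; have [cN|] := pselect (coupled_from N1 om); last by right.
    left; rewrite (past_limitE (past_state_stable cN)) //.
    by rewrite -(past_state_stable cN (n := N + L)) // (leq_trans (leq_maxr r N1)) ?leq_addr.
  rewrite (le_trans (measureU2 _ mU (measurableC (mc N1)))) //.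
  by rewrite -[leRHS]add0e leeD2r.
move=> /(le_trans Ge) /le_lt_trans /(_ N1P); rewrite lte_fin; lra.
Qed.

End Limit.

Theorem theorem2 (R : realType) (C S : finType) (M : matching_structure C S)
    (phi : admissible_policy M) (P : probability (Omega M) R)
    (phi_sub : sub_additive phi)
    (erasing : forall u : state C S, balanced_detail M u ->
       exists c s, erasing_couple phi u c s)
    (P_iid : iid P)
    (P_support : full_support P)
    (tau_int : forall V : Omega M -> state C S, Vinfty P V ->
       P.-integrable setT (tau1 R phi V)) :
  exists U : Omega M -> state C S,
    [/\ balanced_rv U /\ stationary_solution P phi U,
        (0 < P [set om | U om = empty_state C S])%E,
        forall V : Omega M -> state C S, Vinfty P V ->
          strong_backwards_coupling P phi V U &
        forall U' : Omega M -> state C S,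
          balanced_rv U' -> stationary_solution P phi U' ->
          {ae P, forall om, U' om = U om}].
Proof.
exists (past_limit phi); split.
- split; first exact: balanced_past_limit.
  exact: past_limit_stationary.
- exact: P_past_limit_empty.
- by move=> V; exact: strong_coupling.
by move=> U'; exact: stationary_unique.
Qed.
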